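(* Let $M,M'$ be left $\mathbb{O}$-modules and $M''$ an $\mathbb{O}$-bimodule. If $f\in\operatorname{Hom}_{\mathcal{LO}}(M',M'')$ and $g\in\operatorname{Hom}_{\mathbb{R}}(M,M')$, then $$f\circledcirc g\in\operatorname{Hom}_{\mathcal{LO}}(M,M'').$$
   Context: $\mathbb{O}$ is the real algebra of octonions with standard basis $e_0=1,e_1,\dots,e_7$. A left $\mathbb{O}$-module is a real vector space $M$ with an $\mathbb{R}$-bilinear unital multiplication $\mathbb{O}\times M\to M$ with $r(rm)=r^2m$ for all $r\in\mathbb{O}$, $m\in M$. Put $[p,q,m]=(pq)m-p(qm)$. An $\mathbb{O}$-bimodule is a left $\mathbb{O}$-module with an $\mathbb{R}$-bilinear unital right multiplication such that $[p,q,m]=[m,p,q]=[q,m,p]$ for all $p,q,m$, where $[m,p,q]=(mp)q-m(pq)$, $[q,m,p]=(qm)p-q(mp)$. For an $\mathbb{O}$-bimodule $N$ let $\mathscr{A}(N)=\{m:[p,q,m]=0\ \forall p,q\}$; one has $N=\bigoplus_{i=0}^7e_i\mathscr{A}(N)$, and $\operatorname{Re}:N\to\mathscr{A}(N)$ is the projection $\sum_ie_ix_i\mapsto x_0$. $\operatorname{Hom}_{\mathbb{R}}$ denotes real linear maps. For a real linear map $f$ between left $\mathbb{O}$-modules put $A_p(x,f)=f(px)-pf(x)$. For a left $\mathbb{O}$-module $M$ and an $\mathbb{O}$-bimodule $N$, $\operatorname{Hom}_{\mathcal{LO}}(M,N)$ is the set of left para-linear maps: $f\in\operatorname{Hom}_{\mathbb{R}}(M,N)$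 with $\operatorname{Re}A_p(x,f)=0$ for all $p\in\mathbb{O}$, $x\in M$. For $f\in\operatorname{Hom}_{\mathbb{R}}(M',M'')$, $g\in\operatorname{Hom}_{\mathbb{R}}(M,M')$ the (left) regular composition is $$(f\circledcirc g)(x)=f(g(x))-\sum_{j=1}^7e_j\operatorname{Re}\big(f(A_{e_j}(x,g))\big).$$ *)

(* Defs.v *)
From HB Require Import structures.
From mathcomp Require Import all_boot all_order all_algebra.
From mathcomp Require Import boolp classical_sets reals.

Set Implicit Arguments.
Unset Strict Implicit.
Unset Printing Implicit Defensive.

Import GRing.Theory.

Local Open Scope ring_scope.

(** * Octonions *)

Notation octonion R := 'rV[R]_8.

Definition obasis (R : realType) (i : 'I_8) : octonion R := delta_mx 0 i.

Definition ounit (R : realType) : octonion R := obasis R ord0.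

(* The oriented lines of the Fano plane: (i, j, k) stands for e_i e_j = e_k. *)
Definition fano : seq (nat * nat * nat) :=
  [:: (1, 2, 3); (1, 4, 5); (1, 7, 6); (2, 4, 6); (2, 5, 7);
      (3, 4, 7); (3, 6, 5)]%N.

Definition fano_cyc (i j k : nat) : bool :=
  [|| (i, j, k) \in fano, (j, k, i) \in fano | (k, i, j) \in fano].

(* The totally antisymmetric symbol equal to 1 on the lines of the plane. *)
Definition oeps (i j k : nat) : int :=
  (fano_cyc i j k)%:Z - (fano_cyc j i k)%:Z.

(* The coefficient of e_k in e_i e_j. *)
Definition ocoef (i j k : nat) : int :=
  if i == 0%N then (j == k)%:Z
  else if j == 0%N then (i == k)%:Z
  else if k == 0%N then - (i == j)%:Z
  else oeps i j k.

Definition omul (R : realType) (p q : octonion R) : octonion R :=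
  \row_(k < 8) \sum_(i < 8) \sum_(j < 8) (ocoef i j k)%:~R * (p 0 i * q 0 j).

Declare Scope oct_scope.
Delimit Scope oct_scope with oct.
Local Open Scope oct_scope.

Reserved Notation "p *oo q" (at level 40, left associativity).
Reserved Notation "p *ol m" (at level 40, left associativity).
Reserved Notation "m *or p" (at level 40, left associativity).

Notation "p *oo q" := (omul p q) : oct_scope.

(** * Left modules and bimodules over the octonions *)

HB.mixin Record Lmodule_isLeftOmodule (R : realType) M
    of GRing.Lmodule R M := {
  olact : octonion R -> M -> M;
  olact_linearl : forall m : M, linear (fun p => olact p m);
  olact_linearr : forall p : octonion R, linear (olact p);
  olact1 : forall m : M, olact (ounit R) m = m;
  olact_alt : forall (r : octonion R) (m : M),
    olact r (olact r m) = olact (omul r r) m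
}.

#[short(type="leftOmodType")]
HB.structure Definition LeftOmodule (R : realType) :=
  { M of Lmodule_isLeftOmodule R M & GRing.Lmodule R M }.

Notation "p *ol m" := (olact p m) : oct_scope.

HB.mixin Record LeftOmodule_isObimodule (R : realType) M
    of LeftOmodule R M := {
  oract : M -> octonion R -> M;
  oract_linearl : forall p : octonion R, linear (fun m : M => oract m p);
  oract_linearr : forall m : M, linear (oract m);
  oract1 : forall m : M, oract m (ounit R) = m;
  oassoc_lr : forall (p q : octonion R) (m : M),
    (p *oo q) *ol m - p *ol (q *ol m) = oract (oract m p) q - oract m (p *oo q);
  oassoc_lm : forall (p q : octonion R) (m : M),
    (p *oo q) *ol m - p *ol (q *ol m) = oract (q *ol m) p - q *ol (oract m p)
}.

#[short(type="obimodType")]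
HB.structure Definition Obimodule (R : realType) :=
  { M of LeftOmodule_isObimodule R M & LeftOmodule R M }.

Notation "m *or p" := (oract m p) : oct_scope.

(** * The associative part and the real part *)

Local Open Scope classical_set_scope.

Definition lassoc (R : realType) (M : leftOmodType R)
    (p q : octonion R) (m : M) : M :=
  (p *oo q) *ol m - p *ol (q *ol m).

Definition assoc_part (R : realType) (N : obimodType R) : set N :=
  [set m | forall p q : octonion R, lassoc p q m = 0].

Arguments assoc_part {R} N _.

(* [a] is the family of components of [x] in N = (+)_i e_i A(N). *)
Definition ocomponents (R : realType) (N : obimodType R)
    (x : N) (a : 'I_8 -> N) : Prop :=
  (forall i, assoc_part N (a i)) /\ x = \sum_(i < 8) obasis R i *ol a i.

(* The e_0-component of [x]. The components exist and are unique in every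
   bimodule, so the default value 0 of [xget] is never used. *)
Definition ore (R : realType) (N : obimodType R) (x : N) : N :=
  xget 0 [set x0 | exists2 a, ocomponents x a & x0 = a ord0].

(** * Para-linear maps *)

Definition HomR (R : realType) (M N : lmodType R) : set (M -> N) :=
  [set f | linear f].

Arguments HomR {R} M N _.

Definition odefect (R : realType) (M N : leftOmodType R)
    (p : octonion R) (x : M) (f : M -> N) : N :=
  f (p *ol x) - p *ol f x.

Definition HomLO (R : realType) (M : leftOmodType R) (N : obimodType R) :
    set (M -> N) :=
  [set f | HomR M N f /\
           forall (p : octonion R) (x : M), ore (odefect p x f) = 0].

Arguments HomLO {R} M N _.

Definition regcomp (R : realType) (M M' : leftOmodType R) (M'' : obimodType R)
    (f : M' -> M'') (g : M -> M') : M -> M'' :=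
  fun x => f (g x)
    - \sum_(j < 8 | j != ord0) obasis R j *ol ore (f (odefect (obasis R j) x g)).

(* Main.v *)
Require Import Defs.
From HB Require Import structures.
From mathcomp Require Import all_boot all_order all_algebra.
From mathcomp Require Import boolp classical_sets reals.

(** Write L_i for the left multiplication by e_i.  A left para-linear map is
    determined by its real part: since x is the sum of the e_i Re(conj(e_i) x),
    para-linearity turns f(y) into the sum of the e_i phi(conj(e_i) y) with
    phi = Re f ([HomLO_para_ext]).  Conversely this formula defines a
    para-linear map for every real linear phi with values in the associative
    part ([para_ext_HomLO]).  Expanding f(g(x)) in this way, the correction
    terms of the regular composition replace e_j g(x) by g(e_j x) inside f, so
    the regular composition is the map attached to phi = Re f g, whence the
    result.

    What has to be built is the real part itself: every element of a bimodule
    has components, they are unique, and the first one is linear in the element.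
    For an oriented line (i, j, k) of the Fano plane put T = - L_i L_j L_k.  As
    the L_i anticommute and square to -1, the seven operators T are commuting
    involutions, and an element is associative exactly when all of them fix it,
    because L_i L_j = L_k T.  In a bimodule the three involutions of the lines
    through one point multiply to the identity ([pencil_linv]); hence, together
    with the identity, they form an action of F_2^3, written S_a for a < 8, with
    S_a S_b = S_(a xor b) ([lsymM]).  The average of the S_a is therefore the
    projection onto the associative part.  Moreover L_i S_a = chi_i(a) S_a L_i
    for the characters chi_i of F_2^3, so the orthogonality relations of
    characters give the expansion of x ([sum_lmule_oavg]) and the vanishing of
    the average on e_i a for i > 0 and a associative ([oavg_lmule]): the average
    is the real part ([oreE]).

    The relation of [pencil_linv] fails in general left modules, for instance
    in the one where p acts on the octonions as multiplication by conj(p), so its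
    proof uses the right multiplication R_i by e_i.  On the (-1)-eigenspace of the involution of a
    line through i one has R_i = - L_i ([rmule_anti]), which is incompatible
    with the commutator of R_i and L_k on the joint eigenspaces where the three
    involutions of the pencil multiply to -1 ([pencil_eigen0]). *)

Set Implicit Arguments.
Unset Strict Implicit.
Unset Printing Implicit Defensive.

Import GRing.Theory Num.Theory.

Local Open Scope ring_scope.
Local Open Scope oct_scope.

(** * Combinatorics of the Fano plane *)

Definition imag (i : nat) : bool := (0 < i < 8)%N.

Lemma all_iota8P (P : pred nat) :
  all P (iota 0 8) -> forall i, (i < 8)%N -> P i.
Proof. by move=> /allP allP i lti; apply: allP; rewrite mem_iota. Qed.

(** Each statement about oriented lines reduces to a computation over the table,
    whose entries are considered up to rotation. *)
Lemma fano_cyc_all (P : nat -> nat -> nat -> bool) :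
    all (fun t => let: (x, y, z) := t in
                  [&& P x y z, P y z x & P z x y]) fano ->
  forall i j k, fano_cyc i j k -> P i j k.
Proof.
by move=> /allP allP i j k /or3P[] /allP /and3P[].
Qed.

Lemma fano_cyc_rot i j k : fano_cyc i j k -> fano_cyc j k i.
Proof. by move: i j k; apply: fano_cyc_all. Qed.

Lemma fano_cyc_imag i j k : fano_cyc i j k -> [/\ imag i, imag j & imag k].
Proof.
move=> ijk; apply/and3P; move: i j k ijk.
by apply: (fano_cyc_all (P := fun i j k => [&& imag i, imag j & imag k])).
Qed.

Lemma fano_cyc_neq i j k : fano_cyc i j k -> [/\ i != j, j != k & i != k].
Proof.
move=> ijk; apply/and3P; move: i j k ijk.
by apply: (fano_cyc_all (P := fun i j k => [&& i != j, j != k & i != k])).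
Qed.

Lemma ocoef0r i k : ocoef i 0 k = (i == k)%:Z.
Proof. by rewrite /ocoef; case: eqP => // ->. Qed.

Lemma ocoef_line i j k l : fano_cyc i j k -> (l < 8)%N ->
  ocoef i j l = (k == l)%:Z.
Proof.
move=> ijk ltl; apply/eqP; move: l ltl; apply: all_iota8P; move: i j k ijk.
apply: (fano_cyc_all (P := fun i j k =>
  all (fun l => ocoef i j l == (k == l)%:Z) (iota 0 8))).
by vm_compute.
Qed.

Lemma ocoef_sqr i l : imag i -> (l < 8)%N -> ocoef i i l = - (0 == l)%:Z.
Proof.
move=> /andP[i_gt0 lti] ltl; apply/eqP; move: l ltl; apply: all_iota8P.
have: (0 < i)%N ==> all (fun l => ocoef i i l == - (0 == l)%:Z) (iota 0 8).
  move: i lti {i_gt0}; apply: all_iota8P; by vm_compute.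
by rewrite i_gt0.
Qed.

Lemma ocoefC i j l : imag i -> imag j -> i != j -> (l < 8)%N ->
  ocoef i j l = - ocoef j i l.
Proof.
move=> /andP[i_gt0 lti] /andP[j_gt0 ltj] neij ltl; apply/eqP.
move: l ltl; apply: all_iota8P.
suff: [&& 0 < i, 0 < j & i != j]%N ==>
    all (fun l => ocoef i j l == - ocoef j i l) (iota 0 8).
  by rewrite i_gt0 j_gt0 neij.
move: i lti j ltj {i_gt0 j_gt0 neij} => i lti j ltj; move: j ltj.
apply: all_iota8P; move: i lti; apply: all_iota8P.
by vm_compute.
Qed.

Lemma fano_cyc_total i j : imag i -> imag j -> i != j ->
  exists k, fano_cyc i j k \/ fano_cyc j i k.
Proof.
move=> /andP[i_gt0 lti] /andP[j_gt0 ltj] neij.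
suff: [&& 0 < i, 0 < j & i != j]%N ==>
    has (fun k => fano_cyc i j k || fano_cyc j i k) (iota 0 8).
  by rewrite i_gt0 j_gt0 neij => /hasP[k _ /orP kP]; exists k.
move: i lti j ltj {i_gt0 j_gt0 neij} => i lti j ltj; move: j ltj.
apply: all_iota8P; move: i lti; apply: all_iota8P.
by vm_compute.
Qed.

(** * The basis octonions *)

Section OctonionBasis.
Variable R : realType.

(** The indices are natural numbers, as in the table of the plane, so that
    relations between them can be checked by computation. *)
Definition oe (n : nat) : octonion R := obasis R (inord n).

Lemma oe_ord (i : 'I_8) : oe i = obasis R i.
Proof. by rewrite /oe inord_val. Qed.

Lemma oe0 : oe 0 = ounit R.
Proof. by rewrite /ounit -oe_ord. Qed.

Lemma oeM i j : (i < 8)%N -> (j < 8)%N ->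
  oe i *oo oe j = \sum_(k < 8) (ocoef i j k)%:~R *: oe k.
Proof.
move=> lti ltj; apply/rowP => k; rewrite summxE [LHS]mxE.
have oeE n (l : 'I_8) : (n < 8)%N -> oe n 0 l = (l == inord n)%:R.
  by rewrite /oe mxE eqxx.
rewrite (bigD1 (inord i)) //= [X in _ + X]big1 ?addr0; last first.
  by move=> a nea; apply: big1 => b _; rewrite oeE // (negPf nea) mul0r mulr0.
rewrite (bigD1 (inord j)) //= [X in _ + X]big1 ?addr0; last first.
  by move=> b neb; rewrite [oe j _ _]oeE // (negPf neb) mulr0 mulr0.
rewrite !oeE // !eqxx !mulr1 !inordK //.
rewrite (bigD1 k) //= [X in _ + X]big1 ?addr0; last first.
  move=> l nel; rewrite mxE oeE // inord_val eq_sym (negPf nel) mulr0 //.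
by rewrite mxE oeE // inord_val eqxx mulr1.
Qed.

Lemma oeM_line i j k : fano_cyc i j k -> oe i *oo oe j = oe k.
Proof.
move=> ijk; have [/andP[_ lti] /andP[_ ltj] /andP[_ ltk]] := fano_cyc_imag ijk.
rewrite oeM // (bigD1 (inord k)) //= big1 ?addr0.
  by rewrite (ocoef_line ijk) // inordK // eqxx scale1r.
move=> l nel; rewrite (ocoef_line ijk) //.
have -> : (k == l) = false.
  by apply: contraNF nel => /eqP->; rewrite inord_val.
by rewrite scale0r.
Qed.

Lemma oeM_sqr i : imag i -> oe i *oo oe i = - oe 0.
Proof.
move=> Ii; have /andP[_ lti] := Ii.
rewrite oeM // (bigD1 ord0) //= big1 ?addr0.
  by rewrite (ocoef_sqr Ii) // scaleNr scale1r.
move=> l nel; rewrite (ocoef_sqr Ii) //.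
have -> : (0%N == l) = false by rewrite eq_sym; apply: negPf nel.
by rewrite scale0r.
Qed.

Lemma oeMC i j : imag i -> imag j -> i != j ->
  oe i *oo oe j = - (oe j *oo oe i).
Proof.
move=> Ii Ij neij; have /andP[_ lti] := Ii; have /andP[_ ltj] := Ij.
rewrite !oeM // -sumrN; apply: eq_bigr => k _.
by rewrite (ocoefC Ii Ij neij) // rmorphN scaleNr.
Qed.

Lemma omulDl (p q r : octonion R) : (p + q) *oo r = p *oo r + q *oo r.
Proof.
apply/rowP => k; rewrite !mxE -big_split; apply: eq_bigr => i _ /=.
rewrite -big_split; apply: eq_bigr => j _ /=.
by rewrite mxE mulrDl mulrDr.
Qed.

Lemma omulDr (p q r : octonion R) : r *oo (p + q) = r *oo p + r *oo q.
Proof.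
apply/rowP => k; rewrite !mxE -big_split; apply: eq_bigr => i _ /=.
rewrite -big_split; apply: eq_bigr => j _ /=.
by rewrite mxE !mulrDr.
Qed.

Lemma omulZl c (p q : octonion R) : (c *: p) *oo q = c *: (p *oo q).
Proof.
apply/rowP => k; rewrite !mxE mulr_sumr; apply: eq_bigr => i _ /=.
by rewrite mulr_sumr; apply: eq_bigr => j _ /=; rewrite mxE -mulrA mulrCA.
Qed.

Lemma omulZr c (p q : octonion R) : p *oo (c *: q) = c *: (p *oo q).
Proof.
apply/rowP => k; rewrite !mxE mulr_sumr; apply: eq_bigr => i _ /=.
rewrite mulr_sumr; apply: eq_bigr => j _ /=.
by rewrite mxE (mulrCA (p 0 i)) [RHS]mulrCA.
Qed.

Lemma omul1l (p : octonion R) : ounit R *oo p = p.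
Proof.
apply/rowP => k; rewrite mxE (bigD1 ord0) //= [X in _ + X]big1 ?addr0.
  rewrite (bigD1 k) //= [X in _ + X]big1 ?addr0 => [|j nejk].
    by rewrite mxE /ocoef !eqxx !mul1r.
  by rewrite /ocoef (negPf nejk : (j == k :> nat) = false) mul0r.
move=> i nei; apply: big1 => j _; rewrite /ounit /obasis mxE (negPf nei).
by rewrite mul0r mulr0.
Qed.

Lemma omul1r (p : octonion R) : p *oo ounit R = p.
Proof.
apply/rowP => k; rewrite mxE (bigD1 k) //= [X in _ + X]big1 ?addr0 => [|i neik].
  rewrite (bigD1 ord0) //= [X in _ + X]big1 ?addr0 => [|j nej0].
    by rewrite mxE ocoef0r !eqxx mulr1 mul1r.
  by rewrite mxE (negPf nej0) !mulr0.
apply: big1 => j _; rewrite mxE eqxx /=; have [->|nej0] := eqVneq j ord0.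
  by rewrite ocoef0r (negPf neik : (i == k :> nat) = false) mul0r.
by rewrite !mulr0.
Qed.

Lemma oct_eq0 (V : lmodType R) (f : octonion R -> V) :
  linear f -> (forall i, (i < 8)%N -> f (oe i) = 0) -> forall p, f p = 0.
Proof.
move=> linf f0 p.
pose F : {linear octonion R -> V} :=
  HB.pack f (GRing.isLinear.Build R (octonion R) V *:%R f linf).
rewrite -[f]/(F : _ -> _) [p]row_sum_delta linear_sum big1 // => i _.
by rewrite linearZ /= -[delta_mx _ _]/(obasis R i) -oe_ord f0 // scaler0.
Qed.

End OctonionBasis.

Arguments oe {R} n.

Lemma eqNr0 (R : realType) (V : lmodType R) (v : V) : v = - v -> v = 0.
Proof.
move=> /eqP; rewrite -subr_eq0 opprK -mulr2n -scaler_nat scaler_eq0 pnatr_eq0.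
by move=> /eqP.
Qed.

(** * Left multiplications by the basis units *)

Section LeftModule.
Variables (R : realType) (M : leftOmodType R).
Implicit Types (m : M) (p q : octonion R).

HB.instance Definition _ p :=
  GRing.isLinear.Build R M M *:%R (@olact R M p) (olact_linearr p).

Definition olactl m p : M := p *ol m.

HB.instance Definition _ m :=
  GRing.isLinear.Build R (octonion R) M *:%R (olactl m) (olact_linearl m).

Lemma olactDl p q m : (p + q) *ol m = p *ol m + q *ol m.
Proof. exact: (linearD (olactl m)). Qed.

Lemma olactNl p m : (- p) *ol m = - (p *ol m).
Proof. exact: (linearN (olactl m)). Qed.

Lemma olactZl c p m : (c *: p) *ol m = c *: (p *ol m).
Proof. by rewrite -[LHS]/(olactl m _) linearZ. Qed.

Lemma lassoc0l p m : lassoc (oe 0) p m = 0.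
Proof. by rewrite /lassoc oe0 omul1l olact1 subrr. Qed.

Lemma lassoc0r p m : lassoc p (oe 0) m = 0.
Proof. by rewrite /lassoc oe0 omul1r olact1 subrr. Qed.

(** Polarization of left alternativity. *)
Lemma olact_alt2 p q m :
  p *ol (q *ol m) + q *ol (p *ol m) = (p *oo q) *ol m + (q *oo p) *ol m.
Proof.
have := olact_alt (p + q) m.
rewrite omulDl !omulDr !olactDl !linearD /= -!olact_alt -!addrA.
by move=> /addrI; rewrite !addrA => /addIr.
Qed.

Definition lmule (i : nat) m : M := oe i *ol m.

HB.instance Definition _ i := GRing.Linear.copy (lmule i) (@olact R M (oe i)).

Lemma lmuleN i m : lmule i (- m) = - lmule i m.
Proof. exact: linearN. Qed.

Lemma lmuleB i m n : lmule i (m - n) = lmule i m - lmule i n.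
Proof. exact: linearB. Qed.

Lemma lmule0 m : lmule 0 m = m.
Proof. by rewrite /lmule oe0 olact1. Qed.

Lemma lmuleK i m : imag i -> lmule i (lmule i m) = - m.
Proof.
by move=> Ii; rewrite /lmule olact_alt oeM_sqr // olactNl oe0 olact1.
Qed.

Lemma lmuleC i j m : imag i -> imag j -> i != j ->
  lmule i (lmule j m) = - lmule j (lmule i m).
Proof.
move=> Ii Ij neij; apply/eqP; rewrite -addr_eq0 olact_alt2.
by rewrite (oeMC _ Ii Ij neij) olactNl addNr.
Qed.

Lemma lmule_eq0 i m : imag i -> lmule i m = 0 -> m = 0.
Proof.
move=> Ii im0; rewrite -[m]opprK -(lmuleK m Ii) im0.
by rewrite [lmule i 0]linear0 oppr0.
Qed.

(** The sign makes the line involution act as the identity on associative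
    elements, since e_i e_j = e_k forces e_i (e_j (e_k m)) = - m there. *)
Definition linv (i j k : nat) m : M := - lmule i (lmule j (lmule k m)).

Lemma linv_linear i j k : linear (linv i j k).
Proof. by move=> c u v; rewrite /linv !linearP. Qed.

HB.instance Definition _ i j k :=
  GRing.isLinear.Build R M M *:%R (linv i j k) (linv_linear i j k).

Lemma linvN i j k m : linv i j k (- m) = - linv i j k m.
Proof. exact: linearN. Qed.

Lemma linv_rot i j k m : fano_cyc i j k -> linv j k i m = linv i j k m.
Proof.
move=> ijk; have [Ii Ij Ik] := fano_cyc_imag ijk.
have [nij njk nik] := fano_cyc_neq ijk.
rewrite /linv (lmuleC _ Ik Ii) 1?eq_sym // linearN /=.
by rewrite (lmuleC _ Ij Ii) 1?eq_sym // opprK.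
Qed.

(** Moving e_l past e_i, e_j and e_k changes the sign once for each of the three
    indices that differ from l: twice if l lies on the line, else three times.
    This parity yields the characters in the averages below. *)
Lemma lmule_linv i j k l m : fano_cyc i j k -> imag l ->
  lmule l (linv i j k m) =
    (-1) ^+ (l \notin [:: i; j; k]) *: linv i j k (lmule l m).
Proof.
move=> ijk Il; have [Ii Ij Ik] := fano_cyc_imag ijk.
have [nij njk nik] := fano_cyc_neq ijk.
have anti n x : imag n -> lmule l (lmule n x) =
    (-1) ^+ (l != n) *: lmule n (lmule l x).
  move=> In; have [->|ne] := eqVneq l n; first by rewrite scale1r.
  by rewrite lmuleC // scaleN1r.
rewrite /linv linearN /= anti // anti // linearZ /= anti // !linearZ /=.
rewrite !scalerA -!exprD; congr (_ *: _); rewrite !inE !negb_or.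
have [->|nli] := eqVneq l i; first by rewrite nij nik expr2 mulN1r opprK.
have [->|nlj] := eqVneq l j; first by rewrite njk expr2 mulN1r opprK.
have [_|nlk] := eqVneq l k; first by rewrite expr2 mulN1r opprK.
by rewrite exprS expr2 mulN1r mulN1r opprK.
Qed.

Lemma linvK i j k m : fano_cyc i j k -> linv i j k (linv i j k m) = m.
Proof.
move=> ijk; have [Ii Ij Ik] := fano_cyc_imag ijk.
rewrite {1}/linv.
do 3! [rewrite lmule_linv // !inE !eqxx ?orbT scale1r].
have [nij njk nik] := fano_cyc_neq ijk.
rewrite /linv opprK (lmuleC _ Ik Ii) 1?eq_sym // (lmuleC _ Ik Ij) 1?eq_sym //.
rewrite lmuleK // !lmuleN !opprK (lmuleC _ Ij Ii) 1?eq_sym // lmuleN opprK.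
by rewrite !lmuleK // opprK.
Qed.

(** The line involution measures the failure of associativity along the line. *)
Lemma lmule_mul i j k m : fano_cyc i j k ->
  lmule i (lmule j m) = lmule k (linv i j k m).
Proof.
move=> ijk; have [Ii Ij Ik] := fano_cyc_imag ijk.
rewrite lmule_linv // !inE eqxx !orbT scale1r /linv (lmuleK _ Ik).
by rewrite !lmuleN opprK.
Qed.

(** Lines through a common point i share only that index, so the three factors
    e_i, e_l, e_n cross the other involution with signs 1, -1, -1. *)
Lemma linvC i j k l n m : fano_cyc i j k -> fano_cyc i l n ->
    l \notin [:: i; j; k] -> n \notin [:: i; j; k] ->
  linv i l n (linv i j k m) = linv i j k (linv i l n m).
Proof.
move=> ijk iln Nl Nn; have [Ii Il In] := fano_cyc_imag iln.
rewrite {1}/linv lmule_linv // Nn scaleN1r lmuleN.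
rewrite lmule_linv // Nl scaleN1r opprK.
rewrite lmule_linv // !inE eqxx scale1r.
by rewrite {3}/linv linvN.
Qed.

End LeftModule.

(** * Labelling the lines by the nonzero vectors of F_2^3 *)

(** The lines are numbered from 1 by their position in the table.  With this
    numbering the plane is self-dual: three lines meet in a point exactly when
    their numbers form a line, and the third number is the exclusive or of the
    other two. *)
Definition fano_line (a : nat) : nat * nat * nat := nth (0, 0, 0)%N fano a.-1.

(** (-1) ^+ off_line i a is the value at a of the character chi_i of F_2^3: the
    sign picked up when e_i crosses the involution of line a, with label 0
    standing for the identity operator. *)
Definition off_line (i a : nat) : bool :=
  [&& 0 < i, 0 < a & let: (x, y, z) := fano_line a in i \notin [:: x; y; z]]%N.

(** A line involution does not depend on the rotation of the triple, so all the
    lines through a point may be taken to start there. *)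
Definition line_at (i a : nat) : nat * nat * nat :=
  let: (x, y, z) := fano_line a in
  if x == i then (x, y, z) else if y == i then (y, z, x) else (z, x, y).

Lemma fano_line_cyc a : imag a ->
  let: (x, y, z) := fano_line a in fano_cyc x y z.
Proof.
move=> /andP[a_gt0 lta].
have : (0 < a)%N ==> let: (x, y, z) := fano_line a in fano_cyc x y z.
  by move: a lta {a_gt0}; apply: all_iota8P.
by rewrite a_gt0.
Qed.

(** Orthogonality of characters: each line misses 4 points and contains 3. *)
Lemma sum_off_linel a : (a < 8)%N ->
  \sum_(i < 8) (-1) ^+ off_line i a = (if a == 0%N then 8%:Z else 0).
Proof.
do 8! [case: a => [_|a]; first by rewrite !big_ord_recl big_ord0; vm_compute].
by [].
Qed.

(** Dually, 4 lines miss a given point and 3 contain it. *)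
Lemma sum_off_liner i : imag i -> \sum_(a < 8) (-1) ^+ off_line i a = 0 :> int.
Proof.
case: i => // i.
do 7! [case: i => [_|i]; first by rewrite !big_ord_recl big_ord0; vm_compute].
by [].
Qed.

Lemma fano_cyc_lxor a b c : fano_cyc a b c ->
  Nat.lxor a b = c /\ Nat.lxor b a = c.
Proof.
move=> abc.
suff /andP[/eqP-> /eqP->] : (Nat.lxor a b == c) && (Nat.lxor b a == c) by [].
move: a b c abc; apply: (fano_cyc_all (P := fun a b c =>
  (Nat.lxor a b == c) && (Nat.lxor b a == c))).
by vm_compute.
Qed.

Lemma lxor_lt8 a b : (a < 8)%N -> (b < 8)%N -> (Nat.lxor a b < 8)%N.
Proof.
by move=> lta; move: b; apply: all_iota8P; move: a lta; apply: all_iota8P.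
Qed.

Lemma lxorK a b : (a < 8)%N -> (b < 8)%N -> Nat.lxor a (Nat.lxor a b) = b.
Proof.
move=> lta ltb; apply/eqP.
by move: b ltb; apply: all_iota8P; move: a lta; apply: all_iota8P.
Qed.

Lemma lxorss a : (a < 8)%N -> Nat.lxor a a = 0%N.
Proof. by move=> lta; apply/eqP; move: a lta; apply: all_iota8P. Qed.

Lemma lxor0n a : (a < 8)%N -> Nat.lxor 0 a = a.
Proof. by move=> lta; apply/eqP; move: a lta; apply: all_iota8P. Qed.

Lemma lxorn0 a : (a < 8)%N -> Nat.lxor a 0 = a.
Proof. by move=> lta; apply/eqP; move: a lta; apply: all_iota8P. Qed.

Lemma fano_cyc_line x y z : fano_cyc x y z ->
  exists a, imag a /\ line_at x a = (x, y, z).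
Proof.
move=> xyz; pose P x y z :=
  has (fun a => imag a && (line_at x a == (x, y, z))) (iota 0 8).
have /hasP[a _ /andP[Ia /eqP aE]] : P x y z; last by exists a.
by move: x y z xyz; apply: fano_cyc_all; vm_compute.
Qed.

(** Self-duality: lines whose numbers are collinear are concurrent. *)
Lemma pencil_exists a b c : fano_cyc a b c ->
  exists i j k l m n o, [/\ line_at i a = (i, j, k), line_at i b = (i, l, m),
    line_at i c = (i, n, o) & uniq [:: i; j; k; l; m; n; o]].
Proof.
move=> abc; pose P a b c := has (fun i =>
  let: (x, j, k) := line_at i a in let: (y, l, m) := line_at i b in
  let: (z, n, o) := line_at i c in
  [&& x == i, y == i, z == i & uniq [:: i; j; k; l; m; n; o]]) (iota 0 8).
have /hasP[i _] : P a b c.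
  by move: a b c abc; apply: fano_cyc_all; vm_compute.
case aE: (line_at i a) => [[x j] k]; case bE: (line_at i b) => [[y l] m].
case cE: (line_at i c) => [[z n] o] /and4P[/eqP xi /eqP yi /eqP zi U].
by exists i, j, k, l, m, n, o; rewrite aE bE cE xi yi zi.
Qed.

Lemma line_at_cyc i a x y z :
  imag a -> line_at i a = (x, y, z) -> fano_cyc x y z.
Proof.
move=> /fano_line_cyc; rewrite /line_at; case: (fano_line a) => -[x' y'] z' xyz.
case: eqP => _; first by move=> [<- <- <-].
case: eqP => _ [<- <- <-]; first exact: fano_cyc_rot.
by do 2 apply: fano_cyc_rot.
Qed.

(** * Line involutions and their average *)

Section LineSymmetries.
Variables (R : realType) (M : leftOmodType R).
Implicit Types (m : M) (p q : octonion R).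

Definition lsym (a : nat) m : M :=
  if a == 0%N then m else let: (x, y, z) := fano_line a in linv x y z m.

Lemma lsym_linear a : linear (lsym a).
Proof.
move=> c u v; rewrite /lsym; case: (a == _) => //.
by case: (fano_line a) => -[x y] z; rewrite linearP.
Qed.

HB.instance Definition _ a :=
  GRing.isLinear.Build R M M *:%R (lsym a) (lsym_linear a).

Lemma lsym0 m : lsym 0 m = m. Proof. by []. Qed.

Lemma lsymK a m : (a < 8)%N -> lsym a (lsym a m) = m.
Proof.
rewrite /lsym; have [//|a_gt0 lta] := posnP a.
have := @fano_line_cyc a; rewrite /imag a_gt0 lta => /(_ isT).
by case: (fano_line a) => -[x y] z xyz; rewrite linvK.
Qed.

Lemma lsym_line_at i a x y z m : imag a -> line_at i a = (x, y, z) ->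
  lsym a m = linv x y z m.
Proof.
move=> Ia; have := fano_line_cyc Ia; rewrite /lsym /line_at.
have /andP[/gtn_eqF -> _] := Ia.
case: (fano_line a) => -[x' y'] z' xyz.
case: eqP => _; first by move=> [<- <- <-].
case: eqP => _ [<- <- <-]; first exact/esym/linv_rot.
by apply: linv_rot; do 2 apply: fano_cyc_rot.
Qed.

Lemma lmule_lsym i a m : (i < 8)%N -> (a < 8)%N ->
  lmule i (lsym a m) = (-1) ^+ off_line i a *: lsym a (lmule i m).
Proof.
move=> lti lta; have [->|i_gt0] := posnP i; first by rewrite !lmule0 scale1r.
have [->|a_gt0] := posnP a; first by rewrite !lsym0 /off_line andbF scale1r.
rewrite /off_line i_gt0 a_gt0 /lsym gtn_eqF //=.
have := @fano_line_cyc a; rewrite /imag a_gt0 lta => /(_ isT).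
by case: (fano_line a) => -[x y] z xyz; rewrite lmule_linv // /imag i_gt0.
Qed.

Definition oavg m : M := 8%:R^-1 *: \sum_(a < 8) lsym a m.

Lemma oavg_linear : linear oavg.
Proof.
move=> c u v; rewrite /oavg scalerA mulrC -scalerA -scalerDr; congr (_ *: _).
by rewrite scaler_sumr -big_split; apply: eq_bigr => a _; rewrite /= linearP.
Qed.

HB.instance Definition _ := GRing.isLinear.Build R M M *:%R oavg oavg_linear.

Lemma natr8_neq0 : 8%:R != 0 :> R. Proof. by rewrite pnatr_eq0. Qed.

Lemma oavg_id m : (forall a, (a < 8)%N -> lsym a m = m) -> oavg m = m.
Proof.
move=> fixm; rewrite /oavg (eq_bigr (fun=> m)) => [|a _]; last exact: fixm.
by rewrite sumr_const card_ord -scaler_nat scalerA mulVf ?natr8_neq0 // scale1r.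
Qed.

Lemma fixed_linv m : (forall a, (a < 8)%N -> lsym a m = m) ->
  forall x y z, fano_cyc x y z -> linv x y z m = m.
Proof.
move=> fixm x y z /fano_cyc_line[a [Ia aE]].
by rewrite -(lsym_line_at _ Ia aE) fixm //; case/andP: Ia.
Qed.

(** On e_i m the involutions act through the nontrivial character chi_i, which
    has mean 0. *)
Lemma oavg_lmule i m : imag i -> (forall a, (a < 8)%N -> lsym a m = m) ->
  oavg (lmule i m) = 0.
Proof.
move=> Ii fixm; have /andP[_ lti] := Ii; rewrite /oavg.
rewrite (eq_bigr (fun a : 'I_8 => ((-1) ^+ off_line i a)%:~R *: lmule i m)).
  by rewrite -scaler_suml -rmorph_sum sum_off_liner // scale0r scaler0.
move=> a _; rewrite rmorph_sign -{2}[m](fixm a) // lmule_lsym // scalerA.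
by rewrite -signr_addb addbb scale1r.
Qed.

(** For m associative, e_i (e_j m) = (e_i e_j) m is, up to sign, e_k m with
    k > 0, unless i = j. *)
Lemma oavg_lmule2 i j m : imag i -> (j < 8)%N ->
    (forall a, (a < 8)%N -> lsym a m = m) ->
  oavg (lmule i (lmule j m)) = if i == j then - m else 0.
Proof.
move=> Ii ltj fixm; have [<-|neij] := eqVneq i j.
  by rewrite lmuleK // [oavg (- m)]linearN /= oavg_id.
have [->|j_gt0] := posnP j; first by rewrite lmule0 oavg_lmule.
have Ij : imag j by rewrite /imag j_gt0.
have [k [ijk|jik]] := fano_cyc_total Ii Ij neij.
  rewrite (lmule_mul _ ijk) (fixed_linv fixm) // oavg_lmule //.
  by have [] := fano_cyc_imag ijk.
rewrite lmuleC // (lmule_mul _ jik) (fixed_linv fixm) // [oavg (- _)]linearN /=.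
by rewrite oavg_lmule ?oppr0 //; have [] := fano_cyc_imag jik.
Qed.

(** Left multiplication by the conjugate of e_i. *)
Definition lmulec (i : nat) m : M := if i == 0%N then m else - lmule i m.

Lemma lmulec_linear i : linear (lmulec i).
Proof.
by move=> c u v; rewrite /lmulec; case: eqP => _ //; rewrite !linearP.
Qed.

HB.instance Definition _ i :=
  GRing.isLinear.Build R M M *:%R (lmulec i) (lmulec_linear i).

Lemma lmuleKc i m : (i < 8)%N -> lmule i (lmulec i m) = m.
Proof.
rewrite /lmulec; case: posnP => [->|i_gt0 lti]; first by rewrite lmule0.
by rewrite lmuleN lmuleK ?opprK // /imag i_gt0.
Qed.

(** Conjugating S_a by e_i multiplies it by chi_i(a); summing over i leaves only
    the term S_0 = 1, for which the eight signs cancel the factor 1/8. *)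
Lemma sum_lmule_oavg m : \sum_(i < 8) lmule i (oavg (lmulec i m)) = m.
Proof.
rewrite (eq_bigr (fun i : 'I_8 => 8%:R^-1 *: \sum_(a < 8)
    ((-1) ^+ off_line i a)%:~R *: lsym a m)).
  rewrite -scaler_sumr exchange_big /=.
  rewrite (bigD1 ord0) //= [X in _ + X]big1 ?addr0 => [|a ane0].
    rewrite -scaler_suml -rmorph_sum sum_off_linel // scalerA /=.
    by rewrite mulVf ?natr8_neq0 // scale1r.
  rewrite -scaler_suml -rmorph_sum sum_off_linel //.
  by rewrite (negPf ane0 : (a == 0%N :> nat) = false) scale0r.
move=> i _; rewrite /oavg linearZ linear_sum /=; congr (_ *: _).
by apply: eq_bigr => a _; rewrite lmule_lsym // lmuleKc // rmorph_sign.
Qed.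

Lemma lassoc_line i j k m : fano_cyc i j k ->
  lassoc (oe i) (oe j) m = lmule k (m - linv i j k m).
Proof.
move=> ijk; rewrite /lassoc (oeM_line _ ijk) linearB /=; congr (_ - _).
exact: lmule_mul.
Qed.

Lemma lassocC i j m : imag i -> imag j -> i != j ->
  lassoc (oe i) (oe j) m = - lassoc (oe j) (oe i) m.
Proof.
move=> Ii Ij neij; rewrite /lassoc oeMC // olactNl -!/(lmule _ _) -opprD.
by rewrite [in LHS]lmuleC.
Qed.

(** By bilinearity only associators of two basis units matter, and these are
    governed by the involution of the line through the two units. *)
Lemma fixed_lassoc m : (forall a, (a < 8)%N -> lsym a m = m) ->
  forall p q, lassoc p q m = 0.
Proof.
move=> fixm p q.
have lin_p c u v : lassoc (c *: u + v) q m = c *: lassoc u q m + lassoc v q m.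
  rewrite /lassoc omulDl omulZl !olactDl !olactZl scalerBr opprD.
  by rewrite addrACA.
apply: (oct_eq0 (f := fun p => lassoc p q m)) => // i lti.
apply: (oct_eq0 (f := fun q => lassoc (oe i) q m)) => [c u v|j ltj].
  rewrite /lassoc omulDr omulZr !olactDl !olactZl linearP /= scalerBr opprD.
  by rewrite addrACA.
have [->|i_gt0] := posnP i; first by rewrite lassoc0l.
have [->|j_gt0] := posnP j; first by rewrite lassoc0r.
have Ii : imag i by rewrite /imag i_gt0.
have Ij : imag j by rewrite /imag j_gt0.
have [->|neij] := eqVneq i j; first by rewrite /lassoc olact_alt subrr.
have [k [ijk|jik]] := fano_cyc_total Ii Ij neij.
  by rewrite (lassoc_line _ ijk) (fixed_linv fixm) // subrr /lmule linear0.
rewrite lassocC // (lassoc_line _ jik) (fixed_linv fixm) // subrr.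
by rewrite /lmule linear0 oppr0.
Qed.

Lemma lassoc_fixed m : (forall p q, lassoc p q m = 0) ->
  forall a, (a < 8)%N -> lsym a m = m.
Proof.
move=> assm a lta; have [->//|a_gt0] := posnP a.
rewrite /lsym gtn_eqF //; have := @fano_line_cyc a.
rewrite /imag a_gt0 lta => /(_ isT).
case: (fano_line a) => -[x y] z xyz; have [_ _ Iz] := fano_cyc_imag xyz.
apply/esym/eqP; rewrite -subr_eq0 -oppr_eq0 -(lmuleK _ Iz).
by rewrite -(lassoc_line _ xyz) assm /lmule linear0.
Qed.

End LineSymmetries.

(** * Products of commuting involutions *)

(** Splitting into eigenvectors: v is half the sum of v + T v and v - T v, so a
    property stable under both combinations may be tested on eigenvectors. *)
Lemma involution_eq0 (R : realType) (V : lmodType R) (T : {linear V -> V})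
    (Q : V -> Prop) :
    involutive T ->
    (forall (b : bool) v, Q v -> Q (v + (-1) ^+ b *: T v)) ->
    (forall (b : bool) v, Q v -> T v = (-1) ^+ b *: v -> v = 0) ->
  forall v, Q v -> v = 0.
Proof.
move=> TK QT eig v Qv.
have z (b : bool) : v + (-1) ^+ b *: T v = 0.
  apply: (eig b); first exact: QT.
  rewrite linearD linearZ /= TK scalerDr scalerA.
  by rewrite -signr_addb addbb scale1r addrC.
have := z true; rewrite scaleN1r => /subr0_eq vT.
by have /eqP := z false; rewrite scale1r -vT addr_eq0 => /eqP/eqNr0.
Qed.

(** The product T1 T2 T3 is an involution; if its (-1)-eigenspace were nonzero,
    it would contain a joint eigenvector of T1, T2 and T3. *)
Lemma involutions_prod_id (R : realType) (V : lmodType R)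
    (T1 T2 T3 : {linear V -> V}) :
    involutive T1 -> involutive T2 -> involutive T3 ->
    (forall v, T2 (T1 v) = T1 (T2 v)) -> (forall v, T3 (T1 v) = T1 (T3 v)) ->
    (forall v, T3 (T2 v) = T2 (T3 v)) ->
    (forall (b1 b2 : bool) v,
       T1 v = (-1) ^+ b1 *: v -> T2 v = (-1) ^+ b2 *: v ->
       T3 v = - ((-1) ^+ (b1 (+) b2) *: v) -> v = 0) ->
  forall u, T1 (T2 (T3 u)) = u.
Proof.
move=> K1 K2 K3 C12 C13 C23 joint u.
pose P v := T1 (T2 (T3 v)) = - v.
have PD v w : P v -> P w -> P (v + w) by rewrite /P !linearD /= => -> ->.
have PZ c v : P v -> P (c *: v) by rewrite /P !linearZ /= => ->.
have P1 v : P v -> P (T1 v) by rewrite /P => Pv; rewrite C13 C12 Pv linearN.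
have P2 v : P v -> P (T2 v) by rewrite /P => Pv; rewrite C23 -C12 Pv linearN.
(* This element lies in the (-1)-eigenspace of the product. *)
suff : u - T1 (T2 (T3 u)) = 0 by move/subr0_eq.
have : P (u - T1 (T2 (T3 u))).
  by rewrite /P !linearB /= C13 C23 K3 C12 K2 K1 opprK addrC.
apply: (involution_eq0 K1) => [b1 v Pv|b1 {}u Pu T1u].
  by apply: PD => //; apply/PZ/P1.
apply: (involution_eq0 K2 (Q := fun v => P v /\ T1 v = (-1) ^+ b1 *: v)) => //.
  move=> b2 v [Pv T1v]; split; first by apply: PD => //; apply/PZ/P2.
  by rewrite linearD linearZ /= -C12 T1v scalerDr linearZ !scalerA mulrC.
move=> b2 v [Pv T1v] T2v; apply: (joint b1 b2) => //.
rewrite -[LHS]K2 -[T2 (T3 v)]K1 Pv [T1 (- v)]linearN T1v [T2 (- _)]linearN.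
by rewrite [T2 (_ *: _)]linearZ /= T2v scalerA signr_addb.
Qed.

(** * Right multiplications and pencils of lines *)

Section Bimodule.
Variables (R : realType) (N : obimodType R).
Implicit Types m : N.

HB.instance Definition _ (m : N) :=
  GRing.isLinear.Build R (octonion R) N *:%R (@oract R N m) (oract_linearr m).

Definition rmule (i : nat) m : N := m *or oe i.

HB.instance Definition _ i :=
  GRing.isLinear.Build R N N *:%R (rmule i) (oract_linearl (oe i)).

Lemma rmuleN i m : rmule i (- m) = - rmule i m.
Proof. exact: linearN. Qed.

Lemma rmuleK i m : imag i -> rmule i (rmule i m) = - m.
Proof.
move=> Ii; have := oassoc_lr (oe i) (oe i) m.
rewrite olact_alt subrr oeM_sqr // => /esym/eqP; rewrite subr_eq0 => /eqP.
by rewrite /rmule => ->; rewrite linearN /= oe0 oract1.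
Qed.

(** The commutator of a right and a left multiplication is a left associator,
    hence is expressed by left multiplications alone. *)
Lemma rmule_lmule_lassoc i j m :
  rmule i (lmule j m) = lmule j (rmule i m) + lassoc (oe i) (oe j) m.
Proof.
have := oassoc_lm (oe i) (oe j) m; rewrite -/(lassoc _ _ _) => ->.
by rewrite subrKC.
Qed.

Lemma rmule_lmule_same i m :
  rmule i (lmule i m) = lmule i (rmule i m).
Proof.
by rewrite rmule_lmule_lassoc /lassoc olact_alt subrr addr0.
Qed.

Lemma rmule_lmule i j k m : fano_cyc i j k ->
  rmule i (lmule j m) = lmule j (rmule i m) + lmule k (m - linv i j k m).
Proof. by move=> ijk; rewrite rmule_lmule_lassoc (lassoc_line _ ijk). Qed.

Lemma rmule_lmuleV i j k m : fano_cyc i j k ->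
  rmule i (lmule k m) = lmule k (rmule i m) - lmule j (m - linv i j k m).
Proof.
move=> ijk; have [Ii Ij Ik] := fano_cyc_imag ijk.
have [nij njk nik] := fano_cyc_neq ijk.
have kij : fano_cyc k i j by do 2 apply: fano_cyc_rot.
rewrite rmule_lmule_lassoc (lassocC _ Ii Ik nik).
by rewrite (lassoc_line _ kij) (linv_rot _ kij).
Qed.

(** The commutators of R_i with L_j and with L_k contribute opposite terms. *)
Lemma rmule_linv i j k m : fano_cyc i j k ->
  rmule i (linv i j k m) = linv i j k (rmule i m).
Proof.
move=> ijk; have [Ii Ij Ik] := fano_cyc_imag ijk.
rewrite /linv rmuleN rmule_lmule_same.
rewrite (rmule_lmule _ ijk) (rmule_lmuleV _ ijk).
rewrite lmuleB lmuleK // opprK -addrA [X in _ + X](_ : _ = 0) ?addr0 //.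
have -> : linv i j k (lmule k m) = lmule k (linv i j k m).
  by rewrite lmule_linv // !inE eqxx !orbT scale1r.
by rewrite -lmuleB lmuleK // subrr.
Qed.

(** Here (e_j m) e_i - e_j (m e_i) = 2 e_k m and
    (e_k m) e_i - e_k (m e_i) = - 2 e_j m.  Applying R_i twice
    to e_j m and using R_i R_i = -1 gives e_k (m e_i) = e_j m. *)
Lemma rmule_anti i j k m : fano_cyc i j k -> linv i j k m = - m ->
  rmule i m = - lmule i m.
Proof.
move=> ijk Tm; have [Ii Ij Ik] := fano_cyc_imag ijk.
have TRm : linv i j k (rmule i m) = - rmule i m.
  by rewrite -rmule_linv // Tm rmuleN.
have := rmuleK (lmule j m) Ii; rewrite (rmule_lmule _ ijk) Tm opprK.
rewrite [rmule i (_ + _)]linearD /= (rmule_lmule _ ijk) TRm opprK rmuleK //.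
rewrite lmuleN -addrA -[RHS]addr0 => /addrI.
rewrite [lmule k (m + m)]linearD /=.
rewrite [rmule i (_ + _)]linearD /= (rmule_lmuleV _ ijk) Tm opprK.
rewrite ![lmule _ (_ + _)]linearD /=.
(* With x = e_k (m e_i) and y = e_j m, the equation is 4 (x - y) = 0. *)
rewrite addrACA (addrA (lmule k _) (lmule k _)) opprD (addrACA (lmule k _)).
move/eqP; rewrite addr_eq0 => /eqP/eqNr0/eqP; rewrite addr_eq0 => /eqP/eqNr0.
move/eqP; rewrite subr_eq0 => /eqP kE.
rewrite -[LHS]opprK -(lmuleK (rmule i m) Ik) kE.
have [_ njk _] := fano_cyc_neq ijk; rewrite lmuleC 1?eq_sym // opprK.
by rewrite (lmule_mul _ (fano_cyc_rot ijk)) (linv_rot _ ijk) Tm lmuleN.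
Qed.

(** Put w = e_k v.  As k lies off the third line, w is negated by the third
    involution, so w e_i = - e_i w.  But v e_i = - e_i v, and v, being fixed by
    the involution of (i, k, k'), satisfies (e_k v) e_i = e_k (v e_i), whence
    w e_i = e_i w. *)
Lemma pencil_eigen0 i j j' k k' l l' (v : N) :
    fano_cyc i j j' -> fano_cyc i k k' -> fano_cyc i l l' ->
    k \notin [:: i; l; l'] ->
    linv i j j' v = - v -> linv i k k' v = v -> linv i l l' v = v ->
  v = 0.
Proof.
move=> ijj' ikk' ill' kNill' T1 T2 T3.
have [Ii Ik _] := fano_cyc_imag ikk'; have [neik _ _] := fano_cyc_neq ikk'.
have T3k : linv i l l' (lmule k v) = - lmule k v.
  by rewrite -{2}T3 lmule_linv // kNill' scaleN1r opprK.
have := rmule_anti ill' T3k.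
rewrite (rmule_lmule _ ikk') T2 subrr [lmule k' 0]linear0 addr0.
rewrite (rmule_anti ijj' T1) lmuleN -lmuleC // => /eqNr0 ikv0.
apply: (lmule_eq0 Ik); exact: (lmule_eq0 Ii).
Qed.

(** Up to sign the product of the three involutions is the product of all seven
    L_i, the volume element of the Clifford algebra that the L_i generate; in a
    bimodule its sign is forced. *)
Lemma pencil_linv i j j' k k' l l' m :
    fano_cyc i j j' -> fano_cyc i k k' -> fano_cyc i l l' ->
    uniq [:: i; j; j'; k; k'; l; l'] ->
  linv i j j' (linv i k k' (linv i l l' m)) = m.
Proof.
move=> ijj' ikk' ill' U.
have [[kj k'j kl] [lj l'j lk l'k] jk jl] :
  [/\ [/\ k \notin [:: i; j; j'], k' \notin [:: i; j; j']
        & k \notin [:: i; l; l']],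
      [/\ l \notin [:: i; j; j'], l' \notin [:: i; j; j'],
          l \notin [:: i; k; k'] & l' \notin [:: i; k; k']],
      j \notin [:: i; k; k'] & j \notin [:: i; l; l']].
  move: U; rewrite /= !inE !negb_or -!andbA; do ![case/andP => ?]; move=> *.
  by do ?split; apply/and3P; split=> //; rewrite eq_sym.
apply: involutions_prod_id => [v|v|v|v|v|v|b1 b2 v].
- exact: linvK.
- exact: linvK.
- exact: linvK.
- exact: linvC.
- exact: linvC.
- exact: linvC.
case: b1 b2 => [] []; rewrite /= ?expr0 ?expr1 ?scaleN1r ?scale1r ?opprK.
all: move=> T1 T2 T3.
(* All three signs are -1: multiplying by e_j flips the last two of them. *)
- have [Ii Ij _] := fano_cyc_imag ijj'; apply: (lmule_eq0 Ij).
  apply: (pencil_eigen0 ijj' ikk' ill' kl).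
  + rewrite -{2}(opprK v) -T1 lmuleN lmule_linv // !inE eqxx orbT scale1r.
    by rewrite opprK.
  + by rewrite -{2}(opprK v) -T2 lmuleN lmule_linv // jk scaleN1r opprK.
  + by rewrite -{2}(opprK v) -T3 lmuleN lmule_linv // jl scaleN1r opprK.
- exact: pencil_eigen0 ijj' ikk' ill' kl T1 T2 T3.
- exact: pencil_eigen0 ikk' ijj' ill' jl T2 T1 T3.
- exact: pencil_eigen0 ill' ijj' ikk' jk T3 T1 T2.
Qed.

Lemma lsym_pencil a b c m : fano_cyc a b c -> lsym a (lsym b m) = lsym c m.
Proof.
move=> abc; have [Ia Ib Ic] := fano_cyc_imag abc.
have [i [j [j' [k [k' [l [l' [aE bE cE U]]]]]]]] := pencil_exists abc.
rewrite -{1}(lsymK m (proj2 (andP Ic))).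
rewrite (lsym_line_at _ Ia aE) (lsym_line_at _ Ib bE) {1}(lsym_line_at _ Ic cE).
apply: pencil_linv => //; first exact: line_at_cyc aE.
  exact: line_at_cyc bE.
exact: line_at_cyc cE.
Qed.

Lemma lsymM a b m : (a < 8)%N -> (b < 8)%N ->
  lsym a (lsym b m) = lsym (Nat.lxor a b) m.
Proof.
move=> lta ltb.
have [->|a_gt0] := posnP a; first by rewrite lxor0n.
have [->|b_gt0] := posnP b; first by rewrite lxorn0.
have [->|neab] := eqVneq a b; first by rewrite lxorss // lsymK.
have Ia : imag a by rewrite /imag a_gt0.
have Ib : imag b by rewrite /imag b_gt0.
have [c [abc|bac]] := fano_cyc_total Ia Ib neab.
  by have [-> _] := fano_cyc_lxor abc; apply: lsym_pencil.
have [_ ->] := fano_cyc_lxor bac.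
by rewrite -(lsym_pencil m (fano_cyc_rot bac)) lsymK.
Qed.

(** * The real part *)

(** Translation by a permutes the group F_2^3, so it preserves the average. *)
Lemma lsym_oavg a m : (a < 8)%N -> lsym a (oavg m) = oavg m.
Proof.
move=> lta; rewrite /oavg linearZ linear_sum /=; congr (_ *: _).
pose h (b : 'I_8) : 'I_8 := Ordinal (lxor_lt8 lta (ltn_ord b)).
have h_inj : injective h.
  by apply: (can_inj (g := h)) => b; apply: val_inj; rewrite /= lxorK.
rewrite [RHS](reindex_inj h_inj); apply: eq_bigr => b _.
by rewrite lsymM.
Qed.

Lemma assoc_partP m : assoc_part N m <-> forall a, (a < 8)%N -> lsym a m = m.
Proof. by split; [exact: lassoc_fixed|exact: fixed_lassoc]. Qed.

Lemma assoc_part_oavg m : assoc_part N (oavg m).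
Proof. by apply/assoc_partP => a lta; apply: lsym_oavg. Qed.

Lemma oavg_ocomponents (x : N) a : ocomponents x a -> oavg x = a ord0.
Proof.
move=> [Aa ->]; rewrite linear_sum (bigD1 ord0) //= big1 => [|i nei0].
  by rewrite addr0 -oe_ord -/(lmule _ _) lmule0 oavg_id //; apply/assoc_partP.
rewrite -oe_ord -/(lmule _ _) oavg_lmule //; last exact/assoc_partP.
by rewrite /imag ltn_ord andbT lt0n.
Qed.

Lemma ocomponents_oavg (x : N) :
  ocomponents x (fun i : 'I_8 => oavg (lmulec i x)).
Proof.
split=> [i|]; first exact: assoc_part_oavg.
by rewrite -[LHS]sum_lmule_oavg; apply: eq_bigr => i _; rewrite -oe_ord.
Qed.

Lemma oreE (x : N) : ore x = oavg x.
Proof.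
rewrite /ore; case: xgetP => [y _ [a xa ->]|/(_ (oavg x))[]].
  by rewrite (oavg_ocomponents xa).
by exists (fun i : 'I_8 => oavg (lmulec i x)); first exact: ocomponents_oavg.
Qed.

End Bimodule.

(** * Para-linear maps and their real parts *)

Section Extension.
Variables (R : realType) (M : leftOmodType R) (N : obimodType R).

Definition para_ext (phi : M -> N) (x : M) : N :=
  \sum_(i < 8) lmule i (phi (lmulec i x)).

(** Only e_i e_i = -1 contributes to the real part of e_i times the expansion:
    the result is - phi(conj(e_i) x) = phi(e_i x) for i > 0. *)
Lemma para_ext_HomLO (phi : {linear M -> N}) :
  (forall x, assoc_part N (phi x)) -> HomLO M N (para_ext phi).
Proof.
move=> Aphi; have lin_ext : linear (para_ext phi).
  move=> c u v; rewrite /para_ext scaler_sumr -big_split; apply: eq_bigr => i _.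
  by rewrite /= !linearP.
have ext_comp x :
    ocomponents (para_ext phi x) (fun i : 'I_8 => phi (lmulec i x)).
  by split=> //; apply: eq_bigr => i _; rewrite -oe_ord.
split=> // p x; rewrite oreE.
apply: (oct_eq0 (f := fun p => oavg (odefect p x (para_ext phi)))).
  move=> c u v.
  rewrite -linearP /= /odefect !olactDl !olactZl lin_ext scalerBr opprD.
  by rewrite addrACA.
move=> i lti; rewrite /odefect -!/(lmule _ _) [oavg (_ - _)]linearB /=.
rewrite (oavg_ocomponents (ext_comp _)) /=.
have [->|i_gt0] := posnP i.
  by rewrite !lmule0 (oavg_ocomponents (ext_comp _)) subrr.
have Ii : imag i by rewrite /imag i_gt0.
rewrite /para_ext [lmule i (\sum_(_ < 8) _)]linear_sum.
rewrite [oavg (\sum_(_ < 8) _)]linear_sum /=.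
rewrite (bigD1 (Ordinal lti)) //= big1 => [|j neji]; last first.
  rewrite oavg_lmule2 //; last exact/assoc_partP.
  by rewrite eq_sym (negPf neji : (j == i :> nat) = false).
rewrite oavg_lmule2 //; last exact/assoc_partP.
rewrite eqxx addr0 opprK /lmulec /= (gtn_eqF i_gt0).
by rewrite [phi (- _)]linearN /= subrr.
Qed.

Lemma HomLO_para_ext (f : M -> N) (y : M) : HomLO M N f ->
  f y = para_ext (fun y => oavg (f y)) y.
Proof.
move=> [linf f0]; rewrite -[LHS]sum_lmule_oavg; apply: eq_bigr => i _.
congr (lmule i _); rewrite /lmulec; case: eqP => // _.
pose F : {linear M -> N} := HB.pack f (GRing.isLinear.Build R M N *:%R f linf).
have := f0 (oe i) y; rewrite oreE /odefect [oavg (_ - _)]linearB /=.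
move=> /subr0_eq E; rewrite -[f (- _)]/(F _) [F (- _)]linearN /=.
rewrite [oavg (- _)]linearN [RHS]linearN /=.
by rewrite /lmule E.
Qed.

End Extension.

Theorem proposition3p29 (R : realType) (M M' : leftOmodType R)
    (M'' : obimodType R) (f : M' -> M'') (g : M -> M') :
  HomLO M' M'' f -> HomR M M' g -> HomLO M M'' (regcomp f g).
Proof.
move=> Hf ling; have linf := Hf.1.
pose F : {linear M' -> M''} :=
  HB.pack f (GRing.isLinear.Build R _ _ *:%R f linf).
pose G : {linear M -> M'} :=
  HB.pack g (GRing.isLinear.Build R _ _ *:%R g ling).
pose phi : {linear M -> M''} := @oavg R M'' \o F \o G.
suff -> : regcomp f g = para_ext phi.
  by apply: para_ext_HomLO => x; apply: assoc_part_oavg.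
apply/funext => x; rewrite /regcomp (HomLO_para_ext (g x) Hf) /para_ext.
rewrite (bigD1 ord0) // [RHS](bigD1 ord0) //= -addrA !lmule0; congr (_ + _).
rewrite -sumrB; apply: eq_bigr => j nej0; rewrite oreE -oe_ord -/(lmule _ _).
rewrite -linearB /=; congr (lmule j _).
rewrite /lmulec (negPf nej0 : (j == 0%N :> nat) = false).
rewrite /odefect -!/(lmule _ _).
have fN u : f (- u) = - f u := linearN F u.
have fB u v : f (u - v) = f u - f v := linearB F u v.
have gN u : g (- u) = - g u := linearN G u.
rewrite gN !fN fB [oavg (_ - _)]linearB /= ![oavg (- _)]linearN /=.
by rewrite opprB addKr.
Qed.
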